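(* Let $G$ be a weighted graph on $N$ vertices with combinatorial Laplacian $L_G$, having eigenvalues $\lambda_\ell$ and orthonormal eigenvectors $u_\ell$ ($\ell=1,\dots,N$). Let $T\ge 1$ be an integer and $\omega_k=2\pi k/T$ for $k=0,\dots,T-1$. Let $\mathcal S$ be a (finite or countable) set of scales, and for each $s\in\mathcal S$ let a complex-valued joint spectral kernel $\widehat W_s(\lambda_\ell,\omega_k)$ be given. Let $S_W$ be the analysis operator of the associated dynamic graph wavelets $\{W_{m,\tau,s}\}$. Put $$A=\min_{\ell,k}\sum_{s\in\mathcal S}\left|\widehat W_s(\lambda_\ell,\omega_k)\right|^2,\qquad B=\max_{\ell,k}\sum_{s\in\mathcal S}\left|\widehat W_s(\lambda_\ell,\omega_k)\right|^2 .$$ If $0<A\le B<\infty$, then for every time-vertex signal $X\in\mathbb R^{N\times T}$ with $\|X\|_2>0$, $$A\,\|X\|_2^2\;\le\;\|S_W(X)\|_2^2\;\le\;B\,\|X\|_2^2 .$$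
   Context: Graph: $G$ is a finite undirected graph with $N$ vertices and symmetric nonnegative weight matrix $W_G$; $D_G$ is the diagonal degree matrix, and $L_G=D_G-W_G$ is symmetric positive semidefinite, with orthonormal eigenbasis $u_1,\dots,u_N$ and eigenvalues $\lambda_1,\dots,\lambda_N$. Time-vertex signal: a matrix $X\in\mathbb R^{N\times T}$, with entry $X(n,t)$ at vertex $n\in\{1,\dots,N\}$ and time $t\in\{0,\dots,T-1\}$ (time is periodic with period $T$). Joint Fourier transform: $\widehat X(\ell,k)=\frac1{\sqrt T}\sum_{n=1}^N\sum_{t=0}^{T-1}X(n,t)\,\overline{u_\ell(n)}\,e^{-\mathrm j\omega_k t}$, with $\mathrm j^2=-1$. Dynamic graph wavelets (atoms) associated with the kernels $\widehat W_s$: for $m\in\{1,\dots,N\}$, $\tau\in\{0,\dots,T-1\}$, $s\in\mathcal S$, $$W_{m,\tau,s}(n,t)=\frac1T\sum_{\ell=1}^N\sum_{k=0}^{T-1}\widehat W_s(\lambda_\ell,\omega_k)\,\overline{u_\ell(n)}\,u_\ell(m)\,e^{-\mathrm j\omega_k(t-\tau)} .$$ Analysis operator: $$\{S_W(X)\}(m,\tau,s)=\sum_{n,t}W_{m,\tau,s}(n,t)X(n,t)=\frac1{\sqrt T}\sum_{\ell,k}\widehat W_s(\lambda_\ell,\omega_k)\,\widehat X(\ell,k)\,u_\ell(m)\,e^{\mathrm j\omega_k\tau}.$$ Norms: $\|X\|_2^2=\sum_{n,t}|X(n,t)|^2$ and $\|S_W(X)\|_2^2=\sum_{m,\tau,s}|\{S_W(X)\}(m,\tau,s)|^2$.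 *)

(* Defs.v *)
From HB Require Import structures.
From mathcomp Require Import all_boot all_order all_algebra.
From mathcomp Require Import all_classical all_reals all_analysis.
From mathcomp Require Import complex.

Set Implicit Arguments.
Unset Strict Implicit.
Unset Printing Implicit Defensive.

Import Order.TTheory GRing.Theory Num.Theory.

Local Open Scope classical_set_scope.
Local Open Scope ring_scope.

Section Graph.
Context {R : realType} {N : nat}.
Implicit Types (W : 'M[R]_N) (lambda : 'I_N -> R) (u : 'I_N -> 'cV[R[i]]_N).

Definition is_weight_matrix W : Prop := W^T = W /\ forall i j, 0 <= W i j.

Definition degree_mx W : 'M[R]_N := diag_mx (\row_i \sum_(j < N) W i j).

Definition laplacian W : 'M[R]_N := degree_mx W - W.

(* Eigenvectors may have complex entries, whence the conjugates below; a real
   orthonormal eigenbasis is the special case of entries of the form x%:C. *)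
Definition orthonormal_eigenbasis W lambda u : Prop :=
  (forall l, map_mx (real_complex R) (laplacian W) *m u l
             = (lambda l)%:C%C *: u l) /\
  (forall l l', \sum_(n < N) (u l n 0)^*%C * u l' n 0 = (l == l')%:R).

End Graph.

Section Wavelets.
Context {R : realType} {N T : nat} {S : countType}.
Implicit Types (lambda : 'I_N -> R) (u : 'I_N -> 'cV[R[i]]_N).
Implicit Types (hW : S -> R -> R -> R[i]) (X : 'M[R]_(N, T)).

Definition expj (x : R) : R[i] := (cos x +i* sin x)%C.

Definition omega (k : 'I_T) : R := 2 * pi * k%:R / T%:R.

(* hW s x w is the value of the kernel of scale s at graph frequency x and
   angular frequency w; only the values at (lambda l, omega k) matter. *)
Definition wavelet lambda u hW (m : 'I_N) (tau : 'I_T) (s : S) :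
    'M[R[i]]_(N, T) :=
  \matrix_(n, t) (T%:R^-1 * \sum_(l < N) \sum_(k < T)
    hW s (lambda l) (omega k) * (u l n 0)^*%C * u l m 0 *
    expj (- (omega k * (t%:R - tau%:R)))).

Definition analysis lambda u hW X (m : 'I_N) (tau : 'I_T) (s : S) : R[i] :=
  \sum_(n < N) \sum_(t < T) wavelet lambda u hW m tau s n t * (X n t)%:C%C.

Definition signal_norm X : R :=
  Num.sqrt (\sum_(n < N) \sum_(t < T) `|X n t| ^+ 2).

(* complex.Re `|z| is the modulus as an element of R: the norm `|z| is itself
   an element of R[i], with zero imaginary part. The norm is extended-real
   since S may be infinite. *)
Definition coeff_norm (Y : 'I_N -> 'I_T -> S -> R[i]) : \bar R :=
  sqrte (\esum_(i in [set: 'I_N * 'I_T * S])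
           ((complex.Re `|Y i.1.1 i.1.2 i.2|) ^+ 2)%:E).

Definition kernel_energy hW (x w : R) : \bar R :=
  \esum_(s in [set: S]) ((complex.Re `|hW s x w|) ^+ 2)%:E.

Definition min_energy lambda hW : \bar R :=
  \big[mine/+oo%E]_(l < N) \big[mine/+oo%E]_(k < T)
    kernel_energy hW (lambda l) (omega k).

Definition max_energy lambda hW : \bar R :=
  \big[maxe/-oo%E]_(l < N) \big[maxe/-oo%E]_(k < T)
    kernel_energy hW (lambda l) (omega k).

End Wavelets.

Arguments min_energy {R N} T {S} lambda hW.
Arguments max_energy {R N} T {S} lambda hW.

(* Main.v *)
(* The joint eigenvectors u_l (x) exp(j omega_k .) / sqrt T form an orthonormal
   basis of the N T-dimensional signal space, and at each scale s the analysis
   operator is diagonal in it, multiplying the (l, k) coefficient by the kernel.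
   Parseval in the vertex-time domain turns the energy at scale s into
   sum_(l, k) |W_s|^2 |Xhat(l, k)|^2; summing over s leaves a combination of the
   kernel energies, whose weights |Xhat(l, k)|^2 sum to ||X||^2 by Plancherel. *)
Require Import Defs.
From mathcomp Require Import all_boot all_order all_algebra.
From mathcomp Require Import all_classical all_reals all_analysis.
From mathcomp Require Import complex ring lra.

Import Order.TTheory GRing.Theory Num.Theory.

Local Open Scope classical_set_scope.
Local Open Scope ring_scope.

(** A one-sided inverse of a square matrix is two-sided; [enum_val] carries families indexed by [I]
    to matrices over ordinals. This turns orthonormal rows into orthonormal columns. *)
Lemma sum_mul_deltaC {F : comNzRingType} {I : finType} {A B : I -> I -> F} :
  (forall i j, \sum_k A i k * B k j = (i == j)%:R) ->
  forall i j, \sum_k B i k * A k j = (i == j)%:R.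
Proof.
move=> AB i j.
pose mx (C : I -> I -> F) := \matrix_(a < #|I|, b < #|I|) C (enum_val a) (enum_val b).
have mulE C D a b : (mx C *m mx D) a b =
    \sum_k C (enum_val a) k * D k (enum_val b).
  rewrite mxE [RHS](reindex_onto enum_val enum_rank) => [|k _]; last exact: enum_rankK.
  by apply: eq_big => k; rewrite ?enum_valK ?eqxx// !mxE.
have /mulmx1C/matrixP/(_ (enum_rank i) (enum_rank j)) : mx A *m mx B = 1%:M.
  by apply/matrixP => a b; rewrite mulE AB mxE (inj_eq enum_val_inj).
by rewrite mulE !enum_rankK mxE (inj_eq enum_rank_inj).
Qed.

Lemma conjcM {R : rcfType} (x y : R[i]) : (x * y)^*%C = x^*%C * y^*%C.
Proof. exact: rmorphM. Qed.

(** Expanding the square and summing over [m] first leaves the Gram matrix of the family [P], which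
    is the identity. *)
Lemma parseval {R : rcfType} {I : finType} {P : I -> I -> R[i]} (c : I -> R[i]) :
  (forall i j, \sum_m (P i m)^*%C * P j m = (i == j)%:R) ->
  \sum_m `|\sum_i c i * P i m| ^+ 2 = \sum_i `|c i| ^+ 2.
Proof.
move=> orthoP.
under eq_bigr => m _ do rewrite sqr_normc rmorph_sum mulr_sumr.
rewrite exchange_big; apply: eq_bigr => j _ /=.
transitivity (\sum_i c i * (c j)^*%C * (j == i)%:R).
  under eq_bigr => m _ do rewrite mulr_suml.
  rewrite exchange_big; apply: eq_bigr => i _ /=.
  rewrite -orthoP mulr_sumr; apply: eq_bigr => m _.
  by rewrite rmorphM /= mulrACA [P i m * _]mulrC.
rewrite (bigD1 j)//= eqxx mulr1 -sqr_normc big1 ?addr0// => i /negPf.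
by rewrite eq_sym => ->; rewrite mulr0.
Qed.

(** [P] is square, so its columns are orthonormal too, and Parseval applies to its conjugate
    transpose. *)
Lemma plancherel {R : rcfType} {I : finType} {P : I -> I -> R[i]} (x : I -> R[i]) :
  (forall i j, \sum_m (P i m)^*%C * P j m = (i == j)%:R) ->
  \sum_i `|\sum_m x m * (P i m)^*%C| ^+ 2 = \sum_m `|x m| ^+ 2.
Proof.
move=> orthoP; apply: (@parseval _ _ (fun m i => (P i m)^*%C) x) => m n.
under eq_bigr => i _ do rewrite conjcK.
exact: (sum_mul_deltaC (A := fun i m => (P i m)^*%C) (B := fun m i => P i m) orthoP m n).
Qed.

Lemma sqr_Re_normc {R : rcfType} (z : R[i]) :
  ((complex.Re `|z| ^+ 2)%:C)%C = `|z| ^+ 2.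
Proof. by rewrite rmorphXn; congr (_ ^+ 2); apply: RRe_real; apply: normr_real. Qed.

Section Expj.
Context {R : realType}.
Implicit Types x y : R.

Lemma expj0 : expj (0 : R) = 1.
Proof. by rewrite /expj cos0 sin0. Qed.

Lemma expjD x y : expj (x + y) = expj x * expj y.
Proof.
by apply/eqP; rewrite eq_complex/= cosD sinD eqxx/= addrC.
Qed.

Lemma conjc_expj x : (expj x)^*%C = expj (- x).
Proof. by rewrite /expj cosN sinN. Qed.

Lemma expj_mulrn x n : expj (x *+ n) = expj x ^+ n.
Proof.
by elim: n => [|n IHn]; rewrite ?mulr0n ?expj0// mulrS expjD IHn exprS.
Qed.

Lemma expj_eq1 x : expj (x *+ 2) = 1 -> sin x = 0.
Proof.
move=> [+ _]; rewrite cos_mulr2n cos2sin2 => h.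
by apply/eqP; rewrite -sqrf_eq0; apply/eqP; lra.
Qed.

Lemma omegaMT {T : nat} (k : 'I_T) : omega k *+ T = (pi *+ 2) *+ k :> R.
Proof.
have T0 : (T%:R : R) != 0.
  by rewrite pnatr_eq0 -lt0n (leq_ltn_trans (leq0n _) (ltn_ord k)).
by rewrite /omega -[LHS]mulr_natr divfK// mulr_natr mulr_natl.
Qed.

Lemma expj_omegaT {T : nat} (k : 'I_T) : expj (omega k : R) ^+ T = 1.
Proof.
by rewrite -expj_mulrn omegaMT expj_mulrn {1}/expj cos2pi sin2pi expr1n.
Qed.

(** For [k' < k] the half-difference is [pi * (k - k') / T], strictly between 0 and [pi], where the
    sine is positive. *)
Lemma sin_omega_half_eq0 {T : nat} (k k' : 'I_T) :
  sin ((omega k - omega k') / 2 : R) = 0 -> k = k'.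
Proof.
wlog ltkk' : k k' / (k' < k)%N.
  move=> wlg; case: (ltngtP k k') => [kk'|k'k|kk' _]; last exact: val_inj.
    by rewrite -opprB mulNr sinN => /eqP; rewrite oppr_eq0 => /eqP/wlg ->.
  exact: wlg.
have T0 : (0 < T)%N := leq_ltn_trans (leq0n _) (ltn_ord k).
have -> : (omega k - omega k') / 2 = pi * ((k - k')%:R / T%:R) :> R.
  by rewrite /omega natrB 1?ltnW//; field; rewrite pnatr_eq0 -lt0n.
move=> s0; suff : (0 < sin (pi * ((k - k')%:R / T%:R)) :> R) by rewrite s0 ltxx.
apply: sin_gt0_pi; rewrite mulr_gt0 ?pi_gt0 ?divr_gt0 ?ltr0n ?subn_gt0//=.
rewrite gtr_pMr ?pi_gt0// ltr_pdivrMr ?ltr0n// mul1r ltr_nat.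
exact: leq_ltn_trans (leq_subr _ _) (ltn_ord k).
Qed.

(** A geometric sum in a [T]-th root of unity [z]: [z ^+ T - 1 = (z - 1) * sum] makes it vanish
    unless [z = 1]. *)
Lemma sum_expj_omega {T : nat} (k k' : 'I_T) :
  \sum_(t < T) expj (- (omega k * t%:R)) * expj (omega k' * t%:R) =
  T%:R * (k == k')%:R :> R[i].
Proof.
pose z : R[i] := expj (omega k' - omega k).
transitivity (\sum_(t < T) z ^+ t).
  apply: eq_bigr => t _; rewrite -expjD -expj_mulrn; congr expj.
  by rewrite -mulr_natr; ring.
have [kk'|kk'] := eqVneq k k'.
  rewrite mulr1 (eq_bigr (fun=> 1)) ?sumr_const ?card_ord// => t _.
  by rewrite /z kk' subrr expj0 expr1n.
rewrite mulr0; apply/eqP; move: (subrX1 z T).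
rewrite {1}/z expjD exprMn expj_omegaT mul1r -conjc_expj -rmorphXn expj_omegaT.
rewrite rmorph1 subrr => /esym/eqP; rewrite mulf_eq0 => /orP[|//].
(* If [z = 1], the sine of [(omega k' - omega k) / 2] vanishes, which forces equal indices. *)
rewrite subr_eq0 => /eqP z1; case/eqP: kk'; symmetry.
apply: sin_omega_half_eq0; apply: expj_eq1.
by rewrite mulr2n -splitr.
Qed.

End Expj.

(** [\esum] is a supremum of finite partial sums, and a nonnegative real factor commutes with
    both. *)
Lemma ge0_esumZl {R : realType} {T : choiceType} (I : set T) (a : T -> \bar R) (r : R) :
  0 <= r -> (forall i, (0 <= a i)%E) ->
  (\esum_(i in I) (r%:E * a i) = r%:E * \esum_(i in I) a i)%E.
Proof.
move=> r0 a0; rewrite /esum -ereal_supZl//; last first.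
  (* The set of partial sums is nonempty: it contains the empty sum. *)
  apply/set0P; exists (\sum_(x \in set0) a x); exists set0 => //.
  exact: fsets_set0.
rewrite image_comp; congr ereal_sup; apply: eq_imagel => A [finA AI] /=.
by rewrite ge0_mule_fsumr.
Qed.

Lemma esum_finType {R : realType} {I : finType} (a : I -> \bar R) :
  (forall i, (0 <= a i)%E) ->
  (\esum_(i in [set: I]) a i = \sum_i a i)%E.
Proof.
move=> a0; rewrite esum_fset//; last exact: finite_finset.
have <- : [set` enum I] = [set: I].
  by apply/seteqP; split => x _ //=; rewrite mem_enum.
by rewrite -big_enum [RHS]fsbig_seq ?enum_uniq.
Qed.

Section Atoms.
Context {R : realType} {N T : nat}.
Context (u : 'I_N -> 'cV[R[i]]_N).
Implicit Types (p q : 'I_N * 'I_T) (X : 'M[R]_(N, T)).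

(* Since atom (l, k) is u_l (x) exp(j omega_k .) / sqrt T, jft X (l, k)
   is the paper's joint Fourier transform of X. *)
Definition atom p q : R[i] :=
  ((Num.sqrt T%:R)^-1)%:C%C * u p.1 q.1 0 * expj (omega p.2 * q.2%:R).

Definition jft X p : R[i] := \sum_q (X q.1 q.2)%:C%C * (atom p q)^*%C.

(** Separating vertex and time factors serves both the orthonormality of the atoms and the wavelet
    formula, whose [1 / T] is the product of two normalizations. *)
Lemma mul_conjc_atom p p' q q' :
  (atom p q)^*%C * atom p' q' = T%:R^-1 * ((u p.1 q.1 0)^*%C * u p'.1 q'.1 0) *
    (expj (- (omega p.2 * q.2%:R)) * expj (omega p'.2 * q'.2%:R)).
Proof.
have -> : T%:R^-1 = ((Num.sqrt T%:R)^-1)%:C%C * ((Num.sqrt T%:R)^-1)%:C%C :> R[i].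
  by rewrite -rmorphM -invfM -expr2 sqr_sqrtr ?ler0n// fmorphV rmorph_nat.
by rewrite /atom !conjcM conjc_expj conjc_real; ring.
Qed.

Lemma atom_orthonormal :
  (forall l l', \sum_(n < N) (u l n 0)^*%C * u l' n 0 = (l == l')%:R) ->
  forall p p', \sum_q (atom p q)^*%C * atom p' q = (p == p')%:R.
Proof.
move=> orthou [l k] [l' k']; under eq_bigr do rewrite mul_conjc_atom.
rewrite -(pair_bigA _ (fun (n : 'I_N) (t : 'I_T) => T%:R^-1 * ((u l n 0)^*%C * u l' n 0) *
  (expj (- (omega k * t%:R)) * expj (omega k' * t%:R))))/=.
under eq_bigr do rewrite -mulr_sumr sum_expj_omega.
(* [T] is invertible because the index [k : 'I_T] exists. *)
rewrite -mulr_suml -mulr_sumr orthou xpair_eqE mulrACA mulVf; last first.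
  by rewrite pnatr_eq0 -lt0n (leq_ltn_trans (leq0n _) (ltn_ord k)).
by rewrite mul1r -natrM mulnb.
Qed.

(** The wavelet expands in the products [(atom p q)^* * atom p (m, tau)]; summing against [X] over
    [q] first produces [jft X p]. *)
Lemma analysisE {S : countType} lambda (hW : S -> R -> R -> R[i]) X m tau s :
  analysis lambda u hW X m tau s =
  \sum_p hW s (lambda p.1) (omega p.2) * jft X p * atom p (m, tau).
Proof.
transitivity (\sum_q \sum_p hW s (lambda p.1) (omega p.2) *
    ((atom p q)^*%C * atom p (m, tau)) * (X q.1 q.2)%:C%C).
  rewrite /analysis pair_bigA; apply: eq_bigr => -[n t] _ /=.
  rewrite mxE pair_bigA mulr_sumr mulr_suml; apply: eq_bigr => -[l k] _ /=.
  rewrite mul_conjc_atom /= -expjD; congr (_ * _).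
  have -> : - (omega k * t%:R) + omega k * tau%:R =
    - (omega k * (t%:R - tau%:R)) :> R by ring.
  ring.
rewrite exchange_big; apply: eq_bigr => p _ /=.
rewrite /jft mulr_sumr mulr_suml; apply: eq_bigr => q _; ring.
Qed.

Context (orthou :
  forall l l', \sum_(n < N) (u l n 0)^*%C * u l' n 0 = (l == l')%:R).

Lemma sum_sqr_jft X :
  \sum_p complex.Re `|jft X p| ^+ 2 = signal_norm X ^+ 2.
Proof.
rewrite sqr_sqrtr; last by do 2![apply: sumr_ge0 => ? _]; exact: sqr_ge0.
rewrite pair_bigA; apply: complexI; rewrite !rmorph_sum /=.
under eq_bigr do rewrite sqr_Re_normc.
rewrite (plancherel _ (atom_orthonormal orthou)); apply: eq_bigr => q _.
by rewrite sqr_normc conjc_real -rmorphM real_normK ?num_real// expr2.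
Qed.

(** Parseval over the positions [(m, tau)], carried out in [R[i]], with the kernel times [jft X p]
    as coefficients. *)
Lemma sum_sqr_analysis {S : countType} lambda (hW : S -> R -> R -> R[i]) X s :
  \sum_q complex.Re `|analysis lambda u hW X q.1 q.2 s| ^+ 2 =
  \sum_p complex.Re `|jft X p| ^+ 2 *
    complex.Re `|hW s (lambda p.1) (omega p.2)| ^+ 2.
Proof.
apply: complexI; rewrite !rmorph_sum /=.
under eq_bigr do rewrite sqr_Re_normc analysisE -surjective_pairing.
rewrite (parseval _ (atom_orthonormal orthou)); apply: eq_bigr => p _.
by rewrite rmorphM /= !sqr_Re_normc normrM exprMn mulrC.
Qed.

(** Nonnegativity of all terms lets the sums over positions, scales and frequencies be exchanged in
    the extended reals. *)
Lemma sqr_coeff_norm {S : countType} lambda (hW : S -> R -> R -> R[i]) X :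
  (coeff_norm (analysis lambda u hW X) ^+ 2 =
  \sum_p (complex.Re `|jft X p| ^+ 2)%:E *
    kernel_energy hW (lambda p.1) (omega p.2))%E.
Proof.
rewrite sqr_sqrte; last by apply: esum_ge0 => *; rewrite lee_fin sqr_ge0.
pose e q s : \bar R := (complex.Re `|analysis lambda u hW X q.1 q.2 s| ^+ 2)%:E.
have e0 q s : (0 <= e q s)%E by rewrite lee_fin sqr_ge0.
transitivity (\esum_(q in [set: 'I_N * 'I_T]) \esum_(s in [set: S]) e q s)%E.
  rewrite esum_esum//; congr esum; by apply/seteqP; split.
rewrite esum_finType; last by move=> q; exact: esum_ge0.
rewrite -esum_sum//.
(* At each fixed scale the sum over positions becomes one over frequencies, which then moves outside
   to expose [kernel_energy]. *)
under eq_esum do rewrite sumEFin sum_sqr_analysis -sumEFin.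
rewrite esum_sum; last by move=> *; rewrite lee_fin mulr_ge0// sqr_ge0.
apply: eq_bigr => p _; rewrite -ge0_esumZl ?sqr_ge0// => s.
by rewrite lee_fin sqr_ge0.
Qed.

End Atoms.

Theorem theorem1 (R : realType) (N T : nat) (S : countType)
    (W : 'M[R]_N) (lambda : 'I_N -> R) (u : 'I_N -> 'cV[R[i]]_N)
    (hW : S -> R -> R -> R[i])
    (HW : is_weight_matrix W)
    (Hu : orthonormal_eigenbasis W lambda u)
    (HT : (1 <= T)%N)
    (HA : (0 < min_energy T lambda hW)%E)
    (HAB : (min_energy T lambda hW <= max_energy T lambda hW)%E)
    (HB : (max_energy T lambda hW < +oo)%E)
    (X : 'M[R]_(N, T))
    (HX : 0 < signal_norm X) :
  (min_energy T lambda hW * (signal_norm X ^+ 2)%:E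
     <= coeff_norm (analysis lambda u hW X) ^+ 2)%E /\
  (coeff_norm (analysis lambda u hW X) ^+ 2
     <= max_energy T lambda hW * (signal_norm X ^+ 2)%:E)%E.
Proof.
case: Hu => _ orthou.
rewrite (sqr_coeff_norm _ orthou) -(sum_sqr_jft _ orthou) -sumEFin.
have g0 p : (0 <= (complex.Re `|jft u X p| ^+ 2)%:E)%E.
  by rewrite lee_fin sqr_ge0.
(* Both sides carry the same weights [|jft X p|^2], so the bounds hold term by term. *)
split; rewrite ge0_sume_distrr//; apply: lee_sum => p _; rewrite muleC.
  (* The extrema are nested: the outer one is bounded at [p.1], the inner one at [p.2]. *)
  apply: lee_wpmul2l => //; apply: le_trans (bigmin_le _ p.1 _) _.
  exact: bigmin_le.
apply: lee_wpmul2r => //; apply: le_trans (le_bigmax _ _ p.1).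
exact: le_bigmax.
Qed.
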